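(* Let $v_0 \in C^1_0$ and let $v(t,\cdot)\in C^1_0$, $t\in\mathbb{R}^+$, be the solution of the initial-value problem $$v_t = (c - \varphi) v_x + \varphi w - \pi m^2 \bar{v} \sinh(x), \quad t>0, \qquad v|_{t=0} = v_0,$$ where $w(t,x) := \int_0^x v(t,y)\,dy$ and $\bar v := \frac{1}{2\pi}\int_{-\pi}^{\pi} v(t,y)\,dy$ (which is independent of $t$). Then, for every $t\in\mathbb{R}^+$, $$\lim_{x \to 0^+} v_x(t,x) = e^t v_0'(0^+) + \left(M v_0(0) - \pi m^2 \bar{v}\right) (e^t - 1)$$ and $$\lim_{x \to 0^-} v_x(t,x) = e^{-t} v_0'(0^-) + \left(M v_0(0) - \pi m^2 \bar{v}\right) (1 - e^{-t}).$$ Consequently, if $v_0 \in C^1_{\rm per}(\mathbb{T})$ with either $v_0(0) \neq \frac{\pi m^2}{M} \bar{v}$ or $v_0'(0) \neq 0$ or both, then $v(t,\cdot) \notin C^1_{\rm per}(\mathbb{T})$ for almost every $t \in \mathbb{R}^+$.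
   Context: $\mathbb{T} = [-\pi,\pi]$ with endpoints identified; $\mathbb{R}^+=[0,\infty)$. $\varphi(x) = \cosh(\pi - |x|)/\sinh(\pi)$ for $x\in\mathbb{T}$, $m = 1/\sinh(\pi)$, $M = \coth(\pi)$, $c = \varphi(0) = M$. $C^1_{0}$ is the space of $v \in H^1_{\rm per}(\mathbb{T})\cap W^{1,\infty}(\mathbb{T})$ such that $v_x$ is continuous on $\mathbb{T}\setminus \{0\}$ with finite one-sided limits at $0^\pm$, with the $W^{1,\infty}$ norm; $v_0'(0^\pm)$ denote these one-sided limits of $v_0'$. The solution is the unique $v\in C(\mathbb{R}^+,C^1_0)\cap C^1(\mathbb{R}^+,C^0_{\rm per}(\mathbb{T}))$ satisfying the equation for $x\in[-\pi,\pi]$, pointwise on both sides of $x=0$. *)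

(* Defs.v *)
From HB Require Import structures.
From mathcomp Require Import all_boot all_order all_algebra.
From mathcomp Require Import all_classical all_reals all_analysis.
Set Implicit Arguments.
Unset Strict Implicit.
Unset Printing Implicit Defensive.
Import Order.TTheory GRing.Theory Num.Theory.
Import numFieldNormedType.Exports.

Local Open Scope classical_set_scope.
Local Open Scope ring_scope.

Section Constants.
Context {R : realType}.
Implicit Types x : R.

Definition cosh x : R := (expR x + expR (- x)) / 2.
Definition sinh x : R := (expR x - expR (- x)) / 2.
Definition coth x : R := cosh x / sinh x.

(* Only meaningful for x in [-pi, pi]; it is never used outside this interval. *)
Definition phi x : R := cosh (pi - `|x|) / sinh pi.
Definition m_cst : R := (sinh pi)^-1.
Definition M_cst : R := coth pi.
Definition c_cst : R := phi 0.

End Constants.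

(* A function on the circle T = [-pi, pi] with endpoints identified is
   represented by its 2 pi-periodic extension to R, so that the derivative at
   the identified point x = -pi = pi is the ordinary two-sided one. *)
Section Circle.
Context {R : realType}.
Implicit Types (u g psi : R -> R) (p : \bar R).

Definition circle : set R := `[- pi, pi].
Definition on_circle u := periodic u (pi *+ 2).

Lemma measurable_circle : measurable (circle : set (measurableTypeR R)).
Proof. exact: measurable_itv. Qed.

Definition circle_measure : {measure set (measurableTypeR R) -> \bar R} :=
  mrestr (@lebesgue_measure R) measurable_circle.

(* \int_0^x u, oriented when x < 0 *)
Definition primitive u (x : R) : R :=
  if 0 <= x then \int[lebesgue_measure]_(y in `[0, x]) u y
  else - \int[lebesgue_measure]_(y in `[x, 0]) u y.

Definition mean u : R :=
  (pi *+ 2)^-1 * \int[lebesgue_measure]_(y in `[- pi, pi]) u y.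

Definition smooth_per psi :=
  on_circle psi /\ forall n x, derivable (derive1n n psi) x 1.

Definition weak_derivative u g := forall psi, smooth_per psi ->
  \int[lebesgue_measure]_(x in circle) (u x * derive1 psi x) =
  - \int[lebesgue_measure]_(x in circle) (g x * psi x).

Definition W1 p u := [/\ on_circle u, u \in Lfun circle_measure p &
  exists2 g, g \in Lfun circle_measure p & weak_derivative u g].

Definition H1per u := W1 2%:E u.
Definition W1oo u := W1 +oo%E u.

Definition C0per u := on_circle u /\ continuous u.

Definition C1per u :=
  [/\ on_circle u, forall x, derivable u x 1 & continuous (derive1 u)].

(* The requirement [continuous u] selects the continuous representative of the
   class of u. *)
Definition C10 u :=
  [/\ H1per u /\ W1oo u, continuous u,
      forall x, circle x -> x != 0 ->
        derivable u x 1 /\ {for x, continuous (derive1 u)},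
      cvg (derive1 u x @[x --> 0^'+]) & cvg (derive1 u x @[x --> 0^'-])].

Definition deriv_right0 u : R := lim (derive1 u x @[x --> 0^'+]).
Definition deriv_left0 u : R := lim (derive1 u x @[x --> 0^'-]).

(* On C10, the weak derivative is represented by derive1 u; the possible junk
   value of derive1 u at the point 0 is not seen by the essential supremum. *)
Definition W1oo_norm u : \bar R :=
  ('N[circle_measure]_+oo[EFin \o u] +
   'N[circle_measure]_+oo[EFin \o derive1 u])%E.

End Circle.

Section Evolution.
Context {R : realType}.

(* v t x stands for v(t, x); only the values at t >= 0 are relevant. *)

Definition time_continuous_C10 (v : R -> R -> R) :=
  (forall t : R, 0 <= t -> C10 (v t)) /\
  forall t : R, 0 <= t ->
    W1oo_norm (v s \- v t) @[s --> within `[0, +oo[ (nbhs t)] --> 0%E.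

(* v is C^1 from [0, +oo[ to the space C0per with the supremum norm, with
   derivative vt (one-sided at t = 0) *)
Definition time_C1_C0per (v vt : R -> R -> R) :=
  [/\ forall t : R, 0 <= t -> C0per (v t) /\ C0per (vt t),
      forall t : R, 0 <= t ->
        {uniform, (fun x => (s - t)^-1 * (v s x - v t x))
                    @[s --> within `[0, +oo[ t^'] --> vt t} &
      forall t : R, 0 <= t ->
        {uniform, vt s @[s --> within `[0, +oo[ (nbhs t)] --> vt t}].

(* Right-hand side of the equation at x for u = v(t, .), where p is the value
   taken for v_x(t, x). *)
Definition rhs (u : R -> R) (p x : R) : R :=
  (c_cst - phi x) * p + phi x * primitive u x
  - pi * m_cst ^+ 2 * mean u * sinh x.

Definition is_solution (v0 : R -> R) (v : R -> R -> R) :=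
  [/\ time_continuous_C10 v, v 0 = v0 &
      exists2 vt, time_C1_C0per v vt &
        forall t : R, 0 < t ->
          [/\ forall x, - pi <= x <= pi -> x != 0 ->
                vt t x = rhs (v t) (derive1 (v t) x) x,
              vt t 0 = rhs (v t) (deriv_right0 (v t)) 0 &
              vt t 0 = rhs (v t) (deriv_left0 (v t)) 0]].

End Evolution.

(* Main.v *)
(* Since [c - phi 0 = 0], the equation gives [v t 0 = v0 0] for all [t], and the
   mean is conserved because the right-hand side is, on each half circle, the
   derivative of [(c - phi) v + phi' w - pi m^2 mean(v) cosh x] (using
   [phi'' = phi] away from 0).  Now divide the equation by [x]: as [x -> 0] on
   the side [s = 1] or [s = -1], [(v t x - v t 0) / x] tends to the one-sided
   derivative [p t], and its time derivative [vt t x / x] tends to [s p t + K]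
   with [K = M v0(0) - pi m^2 mean(v0)], locally uniformly in [t] by continuity
   in W^{1,oo}.  Hence [p' = s p + K].  If both one-sided derivatives start from
   the same value, not both it and [K] being zero, they agree for at most two
   values of [t]. *)
Require Import Defs.
From mathcomp Require Import all_boot all_order all_algebra.
From mathcomp Require Import all_classical all_reals all_analysis.
From mathcomp Require Import ess_sup_inf ring lra.
Import Order.TTheory GRing.Theory Num.Theory.
Import numFieldNormedType.Exports.

Local Open Scope classical_set_scope.
Local Open Scope ring_scope.

(** * Calculus in time on the half-line, and the linear differential equation *)

(* Derivative on [0, +oo[, one-sided at 0, as in [time_C1_C0per]. *)
Definition derivative_nonneg {R : realType} (f df : R -> R) :=
  forall t : R, 0 <= t ->
    (s - t)^-1 * (f s - f t) @[s --> within `[0, +oo[ t^'] --> df t.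

Lemma uniform_cvg_lt {R : realType} (F : set_system R) (f : R -> R -> R)
    (g : R -> R) (e : R) : Filter F -> 0 < e ->
  {uniform, f s @[s --> F] --> g} ->
  \forall s \near F, forall x, `|f s x - g x| < e.
Proof.
move=> FF e0 /(_ [set h | forall x, `|h x - g x| < e]) /=.
apply; apply/uniform_nbhs; exists [set xy | `|xy.2 - xy.1| < e]; split.
  exists e => //= -[x y]; rewrite /ball_/= => xy; rewrite distrC.
  exact: xy.
by move=> h /= hx x; exact: hx.
Qed.

Lemma derivative_nonneg_is_derive {R : realType} (f df : R -> R) (t : R) :
  derivative_nonneg f df -> 0 < t -> is_derive t 1 f (df t).
Proof.
move=> fdf t0.
have dft : h^-1 *: (f (h *: 1 + t) - f t) @[h --> 0^'] --> df t.
  apply/cvgrPdist_lt => e e0.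
  have /cvgrPdist_lt/(_ _ e0)[d /= d0 dP] := fdf t (ltW t0).
  (* Capping the radius by [t] keeps [h + t] nonnegative. *)
  exists (Num.min d t) => /=; first by rewrite lt_min d0.
  move=> h; rewrite /ball_/= sub0r normrN lt_min => /andP[hd ht] h0.
  have := dP (h + t).
  rewrite /ball_/= opprD addrCA subrr addr0 normrN addrK.
  rewrite [h *: 1]mulr1; apply => //.
    by rewrite -subr_eq0 addrK.
  by rewrite in_itv/= andbT; move: ht; rewrite ltr_norml => /andP[]; lra.
split; first by apply/cvg_ex; exists (df t).
by rewrite /derive; apply: cvg_lim dft.
Qed.

Lemma derivative_nonneg_cvg0 {R : realType} (f df : R -> R) :
  derivative_nonneg f df -> f s @[s --> 0^'+] --> f 0.
Proof.
move=> fdf.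
have sf : (s - 0)^-1 * (f s - f 0) @[s --> 0^'+] --> df 0.
  apply: cvg_trans (fdf 0 (lexx _)) => A [d /= d0 dA].
  exists d => //= s sd s0; apply: dA => //; first by rewrite gt_eqF.
  by rewrite in_itv/= ltW.
have id0 : (s : R) @[s --> 0^'+] --> (0 : R).
  by apply: cvg_at_right_filter; exact: cvg_id.
(* The difference quotient converges, so [s] times it tends to 0. *)
have : f 0 + s * ((s - 0)^-1 * (f s - f 0)) @[s --> 0^'+]
    --> f 0 + 0 * df 0.
  by apply: cvgD; [exact: cvg_cst|exact: cvgM id0 sf].
rewrite mul0r addr0; apply: cvg_trans; apply: near_eq_cvg; near=> s.
have s0 : 0 < s by near: s; exact: nbhs_right_gt.
by rewrite /= subr0 mulVKf ?gt_eqF// addrC subrK.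
Unshelve. all: by end_near. Qed.

Lemma is_derive_continuous {R : realType} (f : R -> R) (x l : R) :
  is_derive x 1 f l -> {for x, continuous f}.
Proof.
by move=> [df _]; apply: differentiable_continuous; apply/derivable1_diffP.
Qed.

(** Right continuity at 0 lets the interval start at [a = 0], where only one-sided information on
    [f] is available. *)
Lemma MVT_nonneg {R : realType} (f df : R -> R) (a b : R) :
  (forall t : R, 0 < t -> is_derive t 1 f (df t)) ->
  f s @[s --> 0^'+] --> f 0 -> 0 <= a < b ->
  exists2 c, a < c < b & f b - f a = df c * (b - a).
Proof.
move=> fdf cf0 /andP[a0 ab].
have cft (x : R) : 0 < x -> {for x, continuous f}.
  by move=> /fdf; exact: is_derive_continuous.
have [||c] := @MVT R f df a b ab.
- by move=> x /[!in_itv]/= /andP[ax _]; apply: fdf; exact: le_lt_trans ax.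
- apply/continuous_within_itvP => //; split.
  + by move=> x /[!in_itv]/= /andP[ax _]; apply: cft; exact: le_lt_trans ax.
  + move: a0; rewrite le_eqVlt => /predU1P[<-//|a0].
    by apply: cvg_at_right_filter; exact: cft.
  + apply: cvg_at_left_filter; apply: cft; exact: le_lt_trans ab.
by rewrite in_itv/=; exists c.
Qed.

Lemma derivative_nonneg0_cst {R : realType} (f : R -> R) :
  (forall t : R, 0 < t -> is_derive t 1 f 0) ->
  f s @[s --> 0^'+] --> f 0 ->
  forall t, 0 <= t -> f t = f 0.
Proof.
move=> df cf t; rewrite le_eqVlt => /predU1P[<-//|t0].
have [|c _] := @MVT_nonneg R f (cst 0) 0 t df cf; first by rewrite lexx.
by rewrite mul0r => /eqP; rewrite subr_eq0 => /eqP.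
Qed.

(** The mean value theorem between [t] and [r] in either order. The intermediate time is positive,
    which is where [is_solution] provides the equation. *)
Lemma derivative_nonneg_slope {R : realType} (f df : R -> R) (t r : R) :
  derivative_nonneg f df -> 0 <= t -> 0 <= r -> r != t ->
  exists c, [/\ 0 < c, `|c - t| < `|r - t| & (r - t)^-1 * (f r - f t) = df c].
Proof.
move=> fdf t0 r0 rt.
have dpos (x : R) : 0 < x -> is_derive x 1 f (df x).
  exact: derivative_nonneg_is_derive.
have cf0 := derivative_nonneg_cvg0 _ _ fdf.
have rt0 : r - t != 0 by rewrite subr_eq0.
move: rt; rewrite neq_lt => /orP[rt|tr].
  have [|c /andP[rc ct] fE] := @MVT_nonneg R f df r t dpos cf0.
    by rewrite r0.
  exists c; split; first exact: le_lt_trans rc.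
    by rewrite !ltr0_norm ?subr_lt0// ltrN2 ltrD2r.
  by rewrite -(opprB (f t)) fE -mulrN opprB mulrC mulfK.
have [|c /andP[tc cr] fE] := @MVT_nonneg R f df t r dpos cf0.
  by rewrite t0.
exists c; split; first exact: le_lt_trans tc.
  by rewrite !gtr0_norm ?subr_gt0// ltrD2r.
by rewrite fE mulrC mulfK.
Qed.

(** Integrating factor: since [s * s = 1], the function [expR (- s * t) * (p t + s * K)] has zero
    derivative. *)
Lemma linear_ode_nonneg {R : realType} (p : R -> R) (s K : R) : s * s = 1 ->
  derivative_nonneg p (fun t => s * p t + K) ->
  forall t, 0 <= t -> p t = expR (s * t) * p 0 + s * K * (expR (s * t) - 1).
Proof.
move=> ss pd t t0.
pose f := fun t => expR (- s * t) * (p t + s * K).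
have : f t = f 0.
  apply: (@derivative_nonneg0_cst R f) => // [x x0|].
    have := derivative_nonneg_is_derive _ _ _ pd x0 => dp.
    rewrite /f; apply: is_derive_eq; rewrite /GRing.scale/=.
    by ring: ss.
  apply: cvgM.
    apply: cvg_at_right_filter.
    apply: (@continuous_comp _ _ _ (fun t => - s * t) expR).
      exact: mulrl_continuous.
    exact: continuous_expR.
  apply: cvgD; first exact: derivative_nonneg_cvg0 pd.
  exact: cvg_cst.
rewrite /f mulr0 expR0 mul1r => h.
have : expR (s * t) * (expR (- s * t) * (p t + s * K)) =
    expR (s * t) * (p 0 + s * K).
  by rewrite h.
rewrite mulrA -expRD mulNr subrr expR0 mul1r => /(canRL (addrK _)) ->; ring.
Qed.

(** * Primitives and means of continuous functions *)

Lemma continuous_integrable_itv {R : realType} (u : R -> R) (b0 b1 : bool)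
    (a b : R) :
  continuous u ->
  (@lebesgue_measure R).-integrable
    [set` Interval (BSide b0 a) (BSide b1 b)] (EFin \o u).
Proof.
move=> cu.
have : (@lebesgue_measure R).-integrable `[a, b] (EFin \o u).
  apply: continuous_compact_integrable; first exact: segment_compact.
  exact: continuous_subspaceT.
by apply: integrableS => //; apply: subset_itvScc; rewrite bnd_simp.
Qed.

(** A common base point [a] removes the case split on the sign of [x], so that the fundamental
    theorem of calculus applies across 0. *)
Lemma primitiveE {R : realType} (u : R -> R) (a x : R) : continuous u ->
  a <= 0 -> a <= x ->
  primitive u x = \int[lebesgue_measure]_(y in `[a, x]) u y -
                  \int[lebesgue_measure]_(y in `[a, 0]) u y.
Proof.
move=> cu a0 ax; rewrite /primitive; case: ifPn => [x0|].
  rewrite Rintegral_itvB ?bnd_simp//.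
    by rewrite Rintegral_itv_obnd_cbnd//; apply: continuous_integrable_itv.
  exact: continuous_integrable_itv.
rewrite -ltNge => /ltW x0; rewrite -[RHS]opprB; congr -%R.
rewrite Rintegral_itvB ?bnd_simp//.
  by rewrite Rintegral_itv_obnd_cbnd//; apply: continuous_integrable_itv.
exact: continuous_integrable_itv.
Qed.

Lemma is_derive_primitive {R : realType} (u : R -> R) (x : R) : continuous u ->
  is_derive x 1 (primitive u) (u x).
Proof.
(* [a] lies strictly below both [x] and 0, so [primitiveE] is valid on a whole neighbourhood of
   [x]. *)
move=> cu; pose a := Num.min x 0 - 1.
have [ax a0] : a < x /\ a < 0.
  by rewrite /a; split; rewrite ltrBlDr gt_min ltrDl ltr01 ?orbT.
pose I := fun y => \int[lebesgue_measure]_(z in `[a, y]) u z.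
have [dI I'] : derivable I x 1 /\ derive1 I x = u x.
  apply: (@continuous_FTC1_closed _ _ _ _ (x + 1)) => //; last exact: cu.
    by rewrite ltrDl.
  exact: continuous_integrable_itv.
have dJ : is_derive x 1 (fun y => I y - I 0) (u x).
  have dIu : is_derive x 1 I (u x) by apply: (DeriveDef dI); rewrite -derive1E.
  rewrite -[u x]subr0; exact: (@is_deriveB _ _ _ I (cst (I 0))).
apply: near_eq_is_derive dJ; near=> y.
rewrite (@primitiveE _ u a) ?ltW//.
by near: y; exact: lt_nbhsr.
Unshelve. all: by end_near. Qed.

Lemma primitive0 {R : realType} (u : R -> R) : primitive u 0 = 0.
Proof. by rewrite /primitive lexx set_itv1 Rintegral_set1. Qed.

Lemma continuous_primitive {R : realType} (u : R -> R) : continuous u ->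
  continuous (primitive u).
Proof.
move=> cu x; apply: is_derive_continuous; exact: is_derive_primitive.
Qed.

Lemma meanE {R : realType} (u : R -> R) : continuous u ->
  mean u = (pi *+ 2)^-1 * (primitive u pi - primitive u (- pi)).
Proof.
move=> cu; have p0 := @pi_ge0 R.
rewrite /mean; congr (_ * _).
have Np0 : - pi <= 0 :> R by rewrite oppr_le0.
rewrite (@primitiveE _ u (- pi) pi)// ?ge0_cp//.
rewrite (@primitiveE _ u (- pi) (- pi))//.
by rewrite set_itv1 Rintegral_set1; ring.
Qed.

(** Mean value theorem for the primitive. It turns a bound uniform in space into a bound on the
    mean. *)
Lemma mean_attained {R : realType} (u : R -> R) : continuous u ->
  exists c, mean u = u c.
Proof.
move=> cu; have p0 := @pi_gt0 R.
have [|||c _ h] := @MVT R (primitive u) u (- pi) pi.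
- by rewrite gtrN.
- by move=> x _; exact: is_derive_primitive.
- by apply: continuous_subspaceT; exact: continuous_primitive.
exists c; rewrite meanE// h opprK -mulr2n mulrC mulfK//.
by rewrite mulrn_eq0/= gt_eqF.
Qed.

Lemma meanB {R : realType} (u w : R -> R) : continuous u -> continuous w ->
  mean (u \- w) = mean u - mean w.
Proof.
move=> cu cw; rewrite /mean RintegralB ?mulrBr//.
- exact: continuous_integrable_itv.
- exact: continuous_integrable_itv.
Qed.

Lemma meanZ {R : realType} (u : R -> R) (k : R) : continuous u ->
  mean (fun x => k * u x) = k * mean u.
Proof.
move=> cu; rewrite /mean [RHS]mulrCA; congr (_ * _).
apply: RintegralZl; first exact: measurable_itv.
exact: continuous_integrable_itv.
Qed.

(** By linearity the error is the mean of the error of the spatial difference quotients. This mean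
    is attained at a point, where the uniform estimate applies. *)
Lemma derivative_nonneg_mean {R : realType} (v vt : R -> R -> R) :
  time_C1_C0per v vt ->
  derivative_nonneg (fun t => mean (v t)) (fun t => mean (vt t)).
Proof.
move=> [vc dv _] t t0; apply/cvgrPdist_lt => e e0.
have [[_ cvt] [_ cvtt]] := vc t t0.
have ge0_near : \forall s \near within `[0, +oo[ t^', 0 <= s.
  by exists 1 => //= s _ _; rewrite in_itv/= => /andP[s0 _].
apply: filterS2 ge0_near (uniform_cvg_lt _ _ _ _ _ e0 (dv t t0)) => s s0 hs.
have [_ cvs] := (vc s s0).1.
have cd : continuous (v s \- v t).
  by move=> x; apply: cvgB; [exact: cvs|exact: cvt].
have cZ : continuous (fun x => (s - t)^-1 * (v s \- v t) x).
  by move=> x; apply: cvgM; [exact: cvg_cst|exact: cd].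
rewrite distrC -meanB// -meanZ// -meanB//.
have [|c ->] := mean_attained ((fun x => (s - t)^-1 * (v s \- v t) x) \- vt t).
  by move=> x; apply: cvgB; [exact: cZ|exact: cvtt].
exact: hs.
Qed.

(** * Hyperbolic functions and the two branches of [phi] *)

Lemma sinh_gt0 {R : realType} (x : R) : 0 < x -> 0 < sinh x.
Proof.
by move=> x0; rewrite divr_gt0// subr_gt0 ltr_expR gtrN.
Qed.

Lemma cosh_gt0 {R : realType} (x : R) : 0 < cosh x.
Proof. by rewrite divr_gt0// addr_gt0// expR_gt0. Qed.

Lemma sinh0 {R : realType} : sinh (0 : R) = 0.
Proof. by rewrite /sinh oppr0 subrr mul0r. Qed.

Lemma is_derive_sinh {R : realType} (x : R) : is_derive x 1 sinh (cosh x).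
Proof.
rewrite /sinh /cosh; by apply: is_derive_eq; rewrite /GRing.scale/=; field.
Qed.

Lemma is_derive_cosh {R : realType} (x : R) : is_derive x 1 cosh (sinh x).
Proof.
rewrite /sinh /cosh; by apply: is_derive_eq; rewrite /GRing.scale/=; field.
Qed.

(* The branch of [phi] on the half circle [0 <= s * x], where s = 1 or -1,
   extended analytically. *)
Definition phi_branch {R : realType} (s x : R) : R :=
  cosh (pi - s * x) / sinh pi.

Definition dphi_branch {R : realType} (s x : R) : R :=
  - s * sinh (pi - s * x) / sinh pi.

Lemma is_derive_affine {R : realType} (a s x : R) :
  is_derive x 1 (fun y => a - s * y) (- s).
Proof. by apply: is_derive_eq; rewrite /GRing.scale/=; ring. Qed.

Lemma is_derive_phi_branch {R : realType} (s x : R) :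
  is_derive x 1 (phi_branch s) (dphi_branch s x).
Proof.
rewrite /phi_branch /dphi_branch.
have := @is_derive1_comp R cosh (fun y => pi - s * y) x _ _
  (is_derive_cosh (pi - s * x)) (is_derive_affine pi s x).
move=> d; apply: is_derive_eq; rewrite /GRing.scale/=; ring.
Qed.

Lemma is_derive_dphi_branch {R : realType} (s x : R) : s * s = 1 ->
  is_derive x 1 (dphi_branch s) (phi_branch s x).
Proof.
move=> ss; rewrite /phi_branch /dphi_branch.
have := @is_derive1_comp R sinh (fun y => pi - s * y) x _ _
  (is_derive_sinh (pi - s * x)) (is_derive_affine pi s x).
move=> d; apply: is_derive_eq; rewrite /GRing.scale/=; ring: ss.
Qed.

Lemma sign_cases {R : realType} (s : R) : s * s = 1 -> s = 1 \/ s = -1.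
Proof.
by move/eqP; rewrite -expr2 sqrf_eq1 => /orP[/eqP|/eqP]; [left|right].
Qed.

Lemma phi_branchE {R : realType} (s x : R) : s * s = 1 -> 0 <= s * x ->
  phi x = phi_branch s x.
Proof.
move=> ss sx; rewrite /phi /phi_branch; congr (cosh (_ - _) / _).
case: (sign_cases s ss) sx => ->.
  by rewrite !mul1r => /ger0_norm.
by rewrite !mulN1r oppr_ge0 => /ler0_norm.
Qed.

Lemma c_cstE {R : realType} (s : R) : c_cst = phi_branch s 0.
Proof. by rewrite /c_cst /phi /phi_branch normr0 mulr0. Qed.

(** * The flux and conservation of the mean *)

(* On each half circle [rhs] is the derivative of this flux, which vanishes at
   x = 0 up to the last term since [phi 0 = c]. *)
Definition flux {R : realType} (u : R -> R) (A s x : R) : R :=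
  (c_cst - phi_branch s x) * u x + dphi_branch s x * primitive u x
  - A * cosh x.

(** The terms [dphi_branch s x * u x] from the first two products cancel, and the second derivative
    of the branch is the branch itself. *)
Lemma is_derive_flux {R : realType} (u : R -> R) (A s x : R) : s * s = 1 ->
  continuous u -> derivable u x 1 ->
  is_derive x 1 (flux u A s)
    ((c_cst - phi_branch s x) * derive1 u x +
     phi_branch s x * primitive u x - A * sinh x).
Proof.
move=> ss cu du.
have d1 := is_derive_phi_branch s x.
have d2 := is_derive_dphi_branch s x ss.
have d3 := is_derive_primitive u x cu.
have d4 := is_derive_cosh x.
have d5 : is_derive x 1 u (derive1 u x).
  by apply: (DeriveDef du); rewrite derive1E.
rewrite /flux; apply: is_derive_eq; rewrite /GRing.scale/=; ring.
Qed.

Lemma continuous_flux {R : realType} (u : R -> R) (A s : R) : s * s = 1 ->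
  continuous u -> continuous (flux u A s).
Proof.
move=> ss cu x; apply: cvgB.
  apply: cvgD; apply: cvgM.
  - apply: cvgB; first exact: cvg_cst.
    apply: is_derive_continuous; exact: is_derive_phi_branch.
  - exact: cu.
  - apply: is_derive_continuous; exact: is_derive_dphi_branch.
  - exact: continuous_primitive.
apply: cvgM; first exact: cvg_cst.
apply: is_derive_continuous; exact: is_derive_cosh.
Qed.

(** The primitive of [f] and the flux have the same derivative inside the half circle and are
    continuous up to its ends. The substitution [s * y] maps [[0, pi]] onto either half. *)
Lemma primitive_rhs {R : realType} (u f : R -> R) (s : R) : s * s = 1 ->
  continuous u -> continuous f ->
  (forall x, 0 < s * x < pi -> derivable u x 1) ->
  (forall x, 0 < s * x < pi -> f x = rhs u (derive1 u x) x) ->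
  primitive f (s * pi) =
    flux u (pi * m_cst ^+ 2 * mean u) s (s * pi) -
    flux u (pi * m_cst ^+ 2 * mean u) s 0.
Proof.
move=> ss cu cf du fE; have p0 := @pi_gt0 R.
pose A := pi * m_cst ^+ 2 * mean u.
pose h := fun y => primitive f (s * y) - flux u A s (s * y).
have ds (y : R) : is_derive y 1 (fun y => s * y) s.
  by apply: is_derive_eq; rewrite /GRing.scale/= mulr1.
have [|||y _] := @MVT R h (cst 0) 0 pi; first exact: p0.
- move=> y /[!in_itv]/= /andP[y0 yp].
  have sy : 0 < s * (s * y) < pi by rewrite mulrA ss mul1r y0.
  have d1 := @is_derive1_comp R (primitive f) (fun y => s * y) y _ _
    (is_derive_primitive f (s * y) cf) (ds y).
  have d2 := @is_derive1_comp R (flux u A s) (fun y => s * y) y _ _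
    (is_derive_flux u A s (s * y) ss cu (du _ sy)) (ds y).
  rewrite /h; apply: is_derive_eq.
  rewrite fE// /rhs -/A (phi_branchE s)//; last by case/andP: sy => /ltW.
  by rewrite subrr.
- apply: continuous_subspaceT => y; apply: cvgB.
    apply: (@continuous_comp _ _ _ (fun y => s * y) (primitive f)).
      exact: mulrl_continuous.
    exact: continuous_primitive.
  apply: (@continuous_comp _ _ _ (fun y => s * y) (flux u A s)).
    exact: mulrl_continuous.
  exact: continuous_flux.
rewrite mul0r /h mulr0 primitive0 => /eqP; rewrite subr_eq0 => /eqP; lra.
Qed.

(** The fluxes of the two halves match at both junctions. At 0 each reduces to [- A * cosh 0]; at
    [pi] and [- pi] the function [u] and [cosh] agree, and [dphi_branch] vanishes through its factor
    [sinh 0]. *)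
Lemma mean_rhs {R : realType} (u f : R -> R) : on_circle u ->
  continuous u -> continuous f ->
  (forall x, -pi <= x <= pi -> x != 0 -> derivable u x 1) ->
  (forall x, -pi <= x <= pi -> x != 0 -> f x = rhs u (derive1 u x) x) ->
  mean f = 0.
Proof.
move=> pu cu cf du fE.
have side (s x : R) : s * s = 1 -> 0 < s * x < pi -> (-pi <= x <= pi) /\ x != 0.
  move=> ss; case: (sign_cases s ss) => -> /andP[x0 xp]; split.
  - lra.
  - lra.
  - lra.
  - lra.
have primE (s : R) (ss : s * s = 1) := primitive_rhs u f s ss cu cf
  (fun x sx => du x (side s x ss sx).1 (side s x ss sx).2)
  (fun x sx => fE x (side s x ss sx).1 (side s x ss sx).2).
have h1 := primE 1 (mulr1 1).
have hN1 := primE (- 1) (etrans (mulrNN 1 1) (mulr1 1)).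
have upi : u (- pi) = u pi by rewrite -(pu (- pi)); congr u; ring.
rewrite meanE//; move: h1 hN1; rewrite mul1r mulN1r => -> ->.
rewrite /flux !primitive0 -!c_cstE subrr upi /dphi_branch /phi_branch.
have -> : pi - 1 * pi = 0 :> R by ring.
have -> : pi - -1 * - pi = 0 :> R by ring.
have -> : cosh (- pi) = cosh pi :> R by rewrite /cosh opprK addrC.
rewrite sinh0; ring.
Qed.

(** * Pointwise bounds from the norms in space *)

(** If the essential supremum were below [|g x|], continuity would make [|g|] exceed it on an
    interval around [x] inside the circle, and such an interval has positive measure. *)
Lemma Lnormy_ge {R : realType} (g : R -> R) (x : R) : -pi < x < pi ->
  {for x, continuous g} ->
  (`|g x|%:E <= 'N[circle_measure]_+oo[EFin \o g])%E.
Proof.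
move=> xpi cg; have p0 := @pi_gt0 R.
(* The norm of exponent [+oo] is the essential supremum only when the whole space has positive
   measure. *)
have mu0 : (0 < @circle_measure R [set: R])%E.
  rewrite /circle_measure /= /mrestr setTI /circle lebesgue_measure_itv/=.
  by rewrite lte_fin gtrN// -EFinB lte_fin opprK addr_gt0.
rewrite unlock mu0 leNgt; apply/negP => ess_lt.
have [r ess_r rg] : exists2 r : R,
    (ess_sup circle_measure (abse \o (EFin \o g)) <= r%:E)%E & r < `|g x|.
  move: ess_lt; case: (ess_sup _ _) => [r|//|_].
    by rewrite lte_fin; exists r.
  (* Case of an essential supremum equal to [-oo]: any real below [|g x|] will do. *)
  by exists (`|g x| - 1); [exact: leNye|rewrite gtrBl].
have /ess_supP[N [mN N0 subN]] := ess_r.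
have near_gt : \forall y \near x, r < `|g y| /\ y \in `]-pi, pi[.
  apply: filterI; last by apply: near_in_itvoo; rewrite in_itv.
  by have := cvgr_gt _ (cvg_norm cg); apply.
have [d /= d0 dsub] := near_gt.
pose I : set R := `]x - d, x + d[%classic.
have subIN : I `<=` N `&` circle.
  move=> y; rewrite /I /= in_itv/= => yd.
  have xdy : ball x d y by rewrite -ball_normE /ball_/= distrC ltr_distl.
  have [ry ypi] := dsub y xdy.
  split; last first.
    by move: ypi; rewrite /circle /= !in_itv/= => /andP[/ltW -> /ltW ->].
  by apply: subN => /=; rewrite lee_fin; apply/negP; rewrite -ltNge.
have : (@lebesgue_measure R I <= circle_measure N)%E.
  rewrite /circle_measure /= /mrestr.
  apply: le_measure => //; apply: mem_set; first exact: measurable_itv.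
  by apply: measurableI => //; exact: measurable_circle.
rewrite N0 /I lebesgue_measure_itv/= lte_fin.
rewrite ltrBlDr -addrA ltrDl addr_gt0// -EFinB lee_fin.
have -> : x + d - (x - d) = d + d by ring.
by rewrite leNgt addr_gt0.
Qed.

Lemma C10_near {R : realType} (u : R -> R) (x : R) : C10 u ->
  -pi < x < pi -> x != 0 ->
  \forall y \near x, derivable u y 1 /\ {for y, continuous (derive1 u)}.
Proof.
move=> [_ _ du _ _] xpi x0; near=> y; apply: du.
  have : y \in `]-pi, pi[ by near: y; apply: near_in_itvoo; rewrite in_itv.
  by rewrite /circle /= !in_itv/= => /andP[/ltW -> /ltW ->].
by near: y; apply: open_nbhs_nbhs; split => //; exact: open_neq.
Unshelve. all: by end_near. Qed.

(** Both terms of the norm are nonnegative, so each is below [e], and [Lnormy_ge] makes this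
    pointwise. The derivative may jump at 0, hence the guard [x != 0]. *)
Lemma W1oo_norm_dist {R : realType} (u w : R -> R) (x e : R) :
  C10 u -> C10 w -> -pi < x < pi -> (W1oo_norm (u \- w)%R < e%:E)%E ->
  `|u x - w x| < e /\ (x != 0 -> `|derive1 u x - derive1 w x| < e).
Proof.
move=> Cu Cw xpi; rewrite /W1oo_norm => lte.
have [_ cu _ _ _] := Cu; have [_ cw _ _ _] := Cw.
split=> [|x0]; rewrite -lte_fin; apply: le_lt_trans lte.
  apply: (@le_trans _ _ ('N[circle_measure]_+oo[EFin \o (u \- w)%R])%E).
    apply: (@Lnormy_ge R (u \- w)) => //.
    by apply: cvgB; [exact: cu|exact: cw].
  by rewrite leeDl// Lnorm_ge0.
have Cux := C10_near u x Cu xpi x0; have Cwx := C10_near w x Cw xpi x0.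
(* The identity is needed on a neighbourhood, since it must also transfer continuity at [x]. *)
have duw : \forall y \near x, derive1 u y - derive1 w y = derive1 (u \- w) y.
  apply: filterS2 Cux Cwx => y [du _] [dw _].
  by rewrite !derive1E; exact/esym/(deriveB du dw).
have cuw : {for x, continuous (derive1 (u \- w))}.
  have : derive1 u y - derive1 w y @[y --> x] --> derive1 u x - derive1 w x.
    apply: cvgB; first exact: (nbhs_singleton Cux).2.
    exact: (nbhs_singleton Cwx).2.
  rewrite (nbhs_singleton duw); apply: cvg_trans; exact: near_eq_cvg.
rewrite (nbhs_singleton duw).
apply: (@le_trans _ _ ('N[circle_measure]_+oo[EFin \o derive1 (u \- w)%R])%E).
  exact: (@Lnormy_ge R (derive1 (u \- w))).
by rewrite leeDr// Lnorm_ge0.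
Qed.

(** The radius [d] in time does not depend on [x], so it can be fixed before letting [x] tend to
    0. *)
Lemma time_continuous_C10_dist {R : realType} (v : R -> R -> R) (t e : R) :
  time_continuous_C10 v -> 0 <= t -> 0 < e ->
  exists2 d : R, 0 < d & forall s x, 0 <= s -> `|s - t| < d -> -pi < x < pi ->
    `|v s x - v t x| < e /\
    (x != 0 -> `|derive1 (v s) x - derive1 (v t) x| < e).
Proof.
move=> [Cv cv] t0 e0.
have [d /= d0 dP] : \forall s \near within `[0, +oo[ (nbhs t),
    (W1oo_norm (v s \- v t)%R < e%:E)%E.
  apply: (cv t t0 [set y | (y < e%:E)%E]).
  apply: open_nbhs_nbhs; split; first exact: open_ereal_lt_ereal.
  by rewrite /= lte_fin.
exists d => // s x s0 st xpi.
apply: W1oo_norm_dist => //; [exact: Cv|exact: Cv|].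
by apply: dP; rewrite /ball_/= ?in_itv/= ?s0// distrC.
Qed.

Lemma derivative_nonneg_eval {R : realType} (v vt : R -> R -> R) (x : R) :
  time_C1_C0per v vt ->
  derivative_nonneg (fun t => v t x) (fun t => vt t x).
Proof.
move=> [_ dv _] t t0; apply/cvgrPdist_lt => e e0.
apply: filterS (uniform_cvg_lt _ _ _ _ _ e0 (dv t t0)) => s hs.
by rewrite distrC; exact: hs.
Qed.

(** * One-sided limits and slopes at 0 *)

(* One-sided neighbourhoods of 0: 0^'+ for s = 1 and 0^'- for s = -1. *)
Definition side {R : realType} (s : R) : set_system R :=
  within [set x | 0 < s * x] (nbhs (0 : R)).

#[local] Instance side_filter {R : realType} (s : R) : Filter (side s).
Proof. exact: within_filter. Qed.

Lemma side1 {R : realType} : side (1 : R) = 0^'+.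
Proof.
rewrite /side (_ : [set x | _] = [set x | 0 < x])//.
by apply/funext => x /=; rewrite mul1r.
Qed.

Lemma sideN1 {R : realType} : side (- 1 : R) = 0^'-.
Proof.
rewrite /side (_ : [set x | _] = [set x | x < 0])//.
by apply/funext => x /=; rewrite mulN1r oppr_gt0.
Qed.

Lemma side_proper {R : realType} (s : R) : s * s = 1 -> ProperFilter (side s).
Proof.
move=> ss; case: (sign_cases s ss) => ->; rewrite ?side1 ?sideN1.
  exact: at_right_proper_filter.
exact: at_left_proper_filter.
Qed.

Lemma near_side {R : realType} (s d : R) : s * s = 1 -> 0 < d ->
  \forall x \near side s, 0 < s * x < d.
Proof.
move=> ss d0; exists d => //= x; rewrite /ball_/= sub0r normrN => xd sx.
rewrite sx /=; apply: le_lt_trans xd; apply: (le_trans (ler_norm _)).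
by rewrite normrM; case: (sign_cases s ss) => ->; rewrite ?normrN normr1 mul1r.
Qed.

(** The reflection [s * y] reduces both sides to an interval [[0, s * x]]. The derivative is
    required only strictly between 0 and [x], which allows a corner at 0. *)
Lemma MVT_side {R : realType} (f df : R -> R) (s x : R) : s * s = 1 ->
  0 < s * x -> continuous f ->
  (forall z, 0 < s * z < s * x -> is_derive z 1 f (df z)) ->
  exists2 z, 0 < s * z < s * x & f x - f 0 = df z * x.
Proof.
move=> ss sx cf fdf.
have ds (y : R) : is_derive y 1 (fun y => s * y) s.
  by apply: is_derive_eq; rewrite /GRing.scale/= mulr1.
have [||y] := @MVT R (fun y => f (s * y)) (fun y => df (s * y) * s)
  0 (s * x) sx.
- move=> y /[!in_itv]/= yx.
  apply: (@is_derive1_comp R f (fun y => s * y)); apply: fdf.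
  by rewrite mulrA ss mul1r.
- apply: continuous_subspaceT => y.
  apply: (@continuous_comp _ _ _ (fun y => s * y) f); last exact: cf.
  exact: mulrl_continuous.
rewrite in_itv/= => yx; rewrite mulrA ss mul1r mulr0 subr0 -mulrA.
rewrite [s * (s * x)]mulrA ss mul1r.
by exists (s * y) => //; rewrite mulrA ss mul1r.
Qed.

Lemma side_circle {R : realType} (s x : R) : s * s = 1 -> 0 < s * x < pi ->
  - pi < x < pi /\ x != 0.
Proof.
move=> ss; case: (sign_cases s ss) => -> /andP[x0 xp].
- by split; [lra|rewrite gt_eqF//; lra].
- by split; [lra|rewrite lt_eqF//; lra].
Qed.

(** The slope between 0 and [x] is the derivative at a point even closer to 0 on the same side. *)
Lemma slope_side {R : realType} (u : R -> R) (s l : R) : s * s = 1 -> C10 u ->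
  derive1 u x @[x --> side s] --> l ->
  (u x - u 0) / x @[x --> side s] --> l.
Proof.
move=> ss [_ cu du _ _] ul; apply/cvgrPdist_lt => e e0.
have /cvgrPdist_lt/(_ _ e0)[d /= d0 dP] := ul.
have FS := side_proper s ss.
have dpi0 : 0 < Num.min d pi by rewrite lt_min d0 pi_gt0.
apply: filterS (near_side s _ ss dpi0) => x.
rewrite lt_min => /and3P[sx xd xp].
have [z /andP[z0 zx] xE] : exists2 z, 0 < s * z < s * x &
    u x - u 0 = derive1 u z * x.
  apply: MVT_side => // z /andP[sz zx].
  have [/andP[zp1 zp2] z0] : - pi < z < pi /\ z != 0.
    by apply: (side_circle s) => //; rewrite sz (lt_trans zx).
  have [duz _] : derivable u z 1 /\ {for z, continuous (derive1 u)}.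
    by apply: du => //; rewrite /circle/= in_itv/= !ltW.
  by apply: (DeriveDef duz); rewrite derive1E.
have x0 : x != 0 by apply: contraTneq sx => ->; rewrite mulr0 ltxx.
rewrite xE mulfK//; apply: dP => //=.
rewrite /ball_/= sub0r normrN; apply: lt_trans xd; apply: le_lt_trans zx.
(* Here [|z| = |s * z| = s * z]. *)
rewrite -[leLHS]mul1r -[in leLHS](normr1 R).
have -> : `|1 : R| = `|s| by case: (sign_cases s ss) => ->; rewrite ?normrN.
by rewrite -normrM gtr0_norm.
Qed.

Lemma side_dnbhs {R : realType} (s : R) (P : set R) :
  (\forall x \near 0^', P x) -> \forall x \near side s, P x.
Proof.
move=> [d /= d0 dP]; exists d => //= x xd sx; apply: dP => //.
by apply: contraTneq sx => ->; rewrite mulr0 ltxx.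
Qed.

Lemma side_nbhs {R : realType} (s : R) (P : set R) :
  (\forall x \near (0 : R), P x) -> \forall x \near side s, P x.
Proof. by move=> [d /= d0 dP]; exists d => //= x xd _; exact: dP. Qed.

Lemma is_derive_side {R : realType} (f : R -> R) (s l : R) :
  is_derive (0 : R) 1 f l -> (f x - f 0) / x @[x --> side s] --> l.
Proof.
move=> [df <-].
have : h^-1 *: (f (h *: 1 + 0) - f 0) @[h --> 0^'] --> 'D_1 f 0 by exact: df.
move=> h P /h /(side_dnbhs s) sP; apply: filterS sP => x /=.
by rewrite addr0 [x *: 1]mulr1 [_ *: _]mulrC.
Qed.

(** Each branch has slope [- s] at 0, the two factors [sinh pi] cancelling. This corner of [phi] is
    what puts the sign [s] in the differential equation. *)
Lemma c_phi_side {R : realType} (s : R) : s * s = 1 ->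
  (c_cst - phi x) / x @[x --> side s] --> s.
Proof.
move=> ss; have FS := side_proper s ss.
have d : is_derive (0 : R) 1 (phi_branch s) (- s).
  have := is_derive_phi_branch s 0.
  by rewrite /dphi_branch mulr0 subr0 mulfK// gt_eqF// sinh_gt0// pi_gt0.
have : - ((phi_branch s x - phi_branch s 0) / x) @[x --> side s] --> s.
  by rewrite -[X in _ --> X]opprK; apply: cvgN; exact: is_derive_side.
apply: cvg_trans.
apply: near_eq_cvg; apply: filterS (near_side s 1 ss ltr01) => x /andP[sx _].
by rewrite /= (c_cstE s) (phi_branchE s)// ?ltW// -mulNr opprB.
Qed.

Lemma phi_side {R : realType} (s : R) : s * s = 1 ->
  phi x @[x --> side s] --> M_cst.
Proof.
move=> ss; have FS := side_proper s ss.
have -> : M_cst = phi_branch s 0.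
  by rewrite /M_cst /coth /phi_branch mulr0 subr0.
have : {for 0, continuous (phi_branch s)}.
  by apply: is_derive_continuous; exact: is_derive_phi_branch.
move=> cphi; have : phi_branch s x @[x --> side s] --> phi_branch s 0.
  by move=> P /cphi /(@side_nbhs R s).
apply: cvg_trans; apply: near_eq_cvg.
apply: filterS (near_side s 1 ss ltr01) => x /andP[sx _].
by rewrite (phi_branchE s)// ltW.
Qed.

Lemma sinh_side {R : realType} (s : R) : sinh x / x @[x --> side s] --> (1 : R).
Proof.
have -> : (fun x : R => sinh x / x) = (fun x => (sinh x - sinh 0) / x).
  by apply/funext => x; rewrite sinh0 subr0.
have -> : 1 = cosh 0 :> R by rewrite /cosh oppr0 expR0 -[1 + 1]/(2%:R) divff.
by apply: is_derive_side; exact: is_derive_sinh.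
Qed.

Lemma M_cst_gt0 {R : realType} : 0 < M_cst :> R.
Proof. by rewrite /M_cst /coth divr_gt0// ?cosh_gt0// sinh_gt0// pi_gt0. Qed.

(** * Conserved quantities and one-sided derivatives of a solution *)

(** At [x = 0] the factor [c_cst - phi 0], the primitive and [sinh] all vanish, so the equation
    reads [vt t 0 = 0]. *)
Lemma solution_at0 {R : realType} (v0 : R -> R) (v : R -> R -> R) :
  is_solution v0 v -> forall t, 0 <= t -> v t 0 = v0 0.
Proof.
move=> [_ <- [vt dv veq]].
have dv0 := derivative_nonneg_eval v vt 0 dv.
apply: (@derivative_nonneg0_cst R (fun t => v t 0)); last first.
  exact: derivative_nonneg_cvg0 dv0.
move=> t t0; have [_ h _] := veq t t0.
have := derivative_nonneg_is_derive _ _ t dv0 t0.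
by rewrite h /rhs primitive0 sinh0 /c_cst subrr !mul0r !mulr0 addr0 subrr.
Qed.

Lemma solution_mean {R : realType} (v0 : R -> R) (v : R -> R -> R) :
  is_solution v0 v -> forall t, 0 <= t -> mean (v t) = mean v0.
Proof.
move=> [[Cv _] <- [vt dv veq]].
have dm := derivative_nonneg_mean v vt dv.
apply: (@derivative_nonneg0_cst R (fun t => mean (v t))); last first.
  exact: derivative_nonneg_cvg0 dm.
move=> t t0; have [h _ _] := veq t t0.
have [/(_ t (ltW t0))[[pv cv] [_ cvt]] _ _] := dv.
have mvt : mean (vt t) = 0.
  apply: (mean_rhs (v t)) => // x xpi x0.
  have [_ _ du _ _] := Cv t (ltW t0).
  by apply: (du x _ x0).1; rewrite /circle/= in_itv.
by have := derivative_nonneg_is_derive _ _ t dm t0; rewrite mvt.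
Qed.

(* By the mean value theorem in time, the difference quotient in time of
   [(v t x - v0 0) / x] is [vt c x / x] for some [c] between [t] and [r]; let
   x -> 0 in the equation divided by x. *)
Lemma solution_side_ode {R : realType} (v0 : R -> R) (v : R -> R -> R)
    (p : R -> R) (s : R) : s * s = 1 -> is_solution v0 v ->
  (forall t, 0 <= t -> derive1 (v t) x @[x --> side s] --> p t) ->
  derivative_nonneg p
    (fun t => s * p t + (M_cst * v0 0 - pi * m_cst ^+ 2 * mean v0)).
Proof.
move=> ss sol vp t t0; apply/cvgrPdist_lt => e e0.
have v_0 := solution_at0 v0 v sol; have v_mean := solution_mean v0 v sol.
have [cvC _ [vt dv veq]] := sol; have [Cv _] := cvC.
have FS := side_proper s ss.
set A := pi * m_cst ^+ 2 * mean v0; set a := v0 0 in v_0 *.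
(* With this choice the limit [e' * (1 + 2 * M_cst)] of the bound [B] below is [e / 2]; the half
   restores the strict inequality after the passage to the limit. *)
pose e' := e / (2 * (1 + 2 * M_cst)).
have M0 := @M_cst_gt0 R.
have e'0 : 0 < e' by rewrite divr_gt0// mulr_gt0// addr_gt0// mulr_gt0.
have [d d0 vd] := time_continuous_C10_dist v t e' cvC t0 e'0.
exists d => // r; rewrite /ball_/= distrC => rtd rt.
rewrite in_itv/= andbT => r0.
pose q (y x : R) := (v y x - v y 0) / x.
have ql (y : R) : 0 <= y -> q y x @[x --> side s] --> p y.
  by move=> y0; apply: slope_side => //; [exact: Cv|exact: vp].
pose Q (x : R) := (r - t)^-1 * (q r x - q t x).
have Ql : Q x @[x --> side s] --> (r - t)^-1 * (p r - p t).
  by apply: cvgM; [exact: cvg_cst|apply: cvgB; exact: ql].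
pose k (x : R) := (c_cst - phi x) / x.
(* One term for each replacement: time [c] by [t] in the derivative, [k x] times the derivative by
   its limit, the average of [v c] by [a], [phi x] by [M_cst], and [sinh x / x] by 1. *)
pose B (x : R) := `|k x| * e' + `|k x * derive1 (v t) x - s * p t| +
  `|phi x| * (2 * e') + `|phi x - M_cst| * `|a| + `|A| * `|sinh x / x - 1|.
have Bl : B x @[x --> side s] --> e' * (1 + 2 * M_cst).
  have -> : e' * (1 + 2 * M_cst) = `|s| * e' + `|s * p t - s * p t| +
      `|M_cst| * (2 * e') + `|M_cst - M_cst| * `|a| + `|A| * `|1 - 1|.
    rewrite !subrr !normr0 mul0r mulr0 !addr0 (gtr0_norm M0).
    have -> : `|s| = 1 by case: (sign_cases s ss) => ->; rewrite ?normrN normr1.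
    ring.
  have kl := c_phi_side s ss; have phil := phi_side s ss.
  apply: cvgD; [apply: cvgD; [apply: cvgD; [apply: cvgD|]|]|].
  - by apply: cvgM; [exact: cvg_norm|exact: cvg_cst].
  - apply: cvg_norm; apply: cvgB; last exact: cvg_cst.
    by apply: cvgM => //; exact: vp.
  - by apply: cvgM; [exact: cvg_norm|exact: cvg_cst].
  - apply: cvgM; last exact: cvg_cst.
    by apply: cvg_norm; apply: cvgB => //; exact: cvg_cst.
  - apply: cvgM; first exact: cvg_cst.
    by apply: cvg_norm; apply: cvgB; [exact: sinh_side|exact: cvg_cst].
have QB : \forall x \near side s, `|s * p t + (M_cst * a - A) - Q x| <= B x.
  have [_ cvt _ _ _] := Cv t t0.
  have /cvgrPdist_lt/(_ _ e'0)[d1 /= d10 d1P] := cvt 0.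
  have dpi0 : 0 < Num.min d1 pi by rewrite lt_min d10 pi_gt0.
  apply: filterS (near_side s _ ss dpi0) => x.
  rewrite lt_min => /and3P[sx xd xp].
  have [xpi x0] : - pi < x < pi /\ x != 0.
    by apply: (side_circle s) => //; rewrite sx.
  (* The time [c] varies with [x]; all that is kept is [0 < c] and [|c - t| < d]. *)
  have [c [c0 ct QE]] := derivative_nonneg_slope _ _ t r
    (derivative_nonneg_eval v vt x dv) t0 r0 rt.
  have {}QE : Q x = vt c x / x.
    rewrite /Q /q !v_0// -QE; field.
    by rewrite x0 subr_eq0 rt.
  have cd : `|c - t| < d by exact: lt_trans rtd.
  have c0' := ltW c0.
  have [_ cvc _ _ _] := Cv c c0'.
  (* The average [primitive (v c) x / x] is a value [v c z] with [z] between 0 and [x]. *)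
  have [z /andP[sz zx]] := MVT_side (primitive (v c)) (v c) s x ss sx
    (continuous_primitive (v c) cvc)
    (fun z _ => is_derive_primitive (v c) z cvc).
  rewrite primitive0 subr0 => wE.
  have [zpi z0] : - pi < z < pi /\ z != 0.
    by apply: (side_circle s) => //; rewrite sz (lt_trans zx).
  (* The comparison goes through [v t z]: continuity at 0 is used at the fixed time [t], because a
     radius taken at time [c] would depend on [x]. *)
  have va : `|v c z - a| <= 2 * e'.
    have [vcz _] := vd c z c0' cd zpi.
    have vtz : `|a - v t z| < e'.
      rewrite -(v_0 t t0); apply: d1P; rewrite /ball_/= sub0r normrN.
      apply: lt_trans xd; apply: le_lt_trans zx.
      rewrite -[leLHS]mul1r.
      have -> : 1 = `|s|.
        by case: (sign_cases s ss) => ->; rewrite ?normrN normr1.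
      by rewrite -normrM gtr0_norm.
    have -> : v c z - a = (v c z - v t z) + - (a - v t z) by ring.
    apply: le_trans (ler_normD _ _) _; rewrite normrN.
    have -> : 2 * e' = e' + e' by ring.
    by apply: lerD; exact: ltW.
  have [_ /(_ x0)/ltW dvx] := vd c x c0' cd xpi.
  have [vtE _ _] := veq c c0.
  have -> : s * p t + (M_cst * a - A) - Q x =
      k x * - (derive1 (v c) x - derive1 (v t) x)
      + - (k x * derive1 (v t) x - s * p t)
      + phi x * - (v c z - a)
      + - ((phi x - M_cst) * a)
      + A * (sinh x / x - 1).
    rewrite QE vtE//; last by move: xpi => /andP[/ltW -> /ltW ->].
    rewrite /rhs wE v_mean// -/A /k; field; exact: x0.
  apply: le_trans (ler_normD _ _) _; apply: lerD; last by rewrite normrM.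
  apply: le_trans (ler_normD _ _) _; apply: lerD; last by rewrite normrN normrM.
  apply: le_trans (ler_normD _ _) _; apply: lerD; last first.
    by rewrite normrM normrN ler_wpM2l.
  apply: le_trans (ler_normD _ _) _; apply: lerD; last by rewrite normrN.
  by rewrite normrM normrN ler_wpM2l.
have lim_le : `|s * p t + (M_cst * a - A) - (r - t)^-1 * (p r - p t)| <=
    e' * (1 + 2 * M_cst).
  apply: ler_cvg_to QB => //.
  by apply: cvg_norm; apply: cvgB => //; exact: cvg_cst.
apply: le_lt_trans lim_le _.
have -> : e' * (1 + 2 * M_cst) = e / 2.
  rewrite /e'; field; rewrite gt_eqF//; lra.
by rewrite ltr_pdivrMr// ltr_pMr// ltr1n.
Qed.

(** Taking the one-sided derivative as a functional [l] treats both sides at once, with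
    [p t = l (v t)] in the differential equation. *)
Lemma solution_deriv_side {R : realType} (v0 : R -> R) (v : R -> R -> R)
    (l : (R -> R) -> R) (s : R) : s * s = 1 -> is_solution v0 v ->
  (forall u, C10 u -> derive1 u x @[x --> side s] --> l u) ->
  forall t, 0 <= t -> derive1 (v t) x @[x --> side s] -->
    expR (s * t) * l v0
    + s * (M_cst * v0 0 - pi * m_cst ^+ 2 * mean v0) * (expR (s * t) - 1).
Proof.
move=> ss sol ul t t0; have [[Cv _] v0E _] := sol.
have := linear_ode_nonneg _ s _ ss
  (solution_side_ode v0 v (fun t => l (v t)) s ss sol
  (fun t t0 => ul _ (Cv t t0))) t t0.
by rewrite v0E => <-; exact/ul/Cv.
Qed.

(** * Loss of continuous differentiability *)

Lemma C1per_one_sided {R : realType} (u : R -> R) (a b : R) : C1per u ->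
  derive1 u x @[x --> 0^'+] --> a -> derive1 u x @[x --> 0^'-] --> b ->
  a = derive1 u 0 /\ b = derive1 u 0.
Proof.
move=> [_ _ cu] ua ub; split.
  apply: cvg_unique ua _ => //.
  by apply: cvg_at_right_filter; exact: cu.
apply: cvg_unique ub _ => //.
by apply: cvg_at_left_filter; exact: cu.
Qed.

(* With [z = expR t] the two expressions agree iff
   [(z - 1) * (d * (z + 1) + K * (z - 1)) = 0]. *)
Lemma one_sided_values_eq {R : realType} (d K t : R) : d != 0 \/ K != 0 ->
  expR t * d + K * (expR t - 1) = expR (- t) * d + K * (1 - expR (- t)) ->
  t = 0 \/ t = ln ((K - d) / (K + d)).
Proof.
move=> dK h; have [->|t0] := eqVneq t 0; [by left|right].
have z1 : expR t - 1 != 0.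
  by rewrite subr_eq0 -expR0; apply: contra_neq t0 => /expR_inj.
have zi : expR t * expR (- t) = 1 by rewrite -expRD subrr expR0.
have : (expR t - 1) * (d * (expR t + 1) + K * (expR t - 1)) = 0.
  have : expR t * (expR t * d + K * (expR t - 1)) =
         expR t * (expR (- t) * d + K * (1 - expR (- t))) by rewrite h.
  move: zi; set z := expR t; set y := expR (- t) => zi hz.
  have -> : (z - 1) * (d * (z + 1) + K * (z - 1)) =
    z * (z * d + K * (z - 1)) - z * (y * d + K * (1 - y)) +
    (z * y - 1) * (d - K) by ring.
  by rewrite hz zi !subrr mul0r addr0.
move/eqP; rewrite mulf_eq0 (negbTE z1) /= => /eqP lin.
(* If [K = - d], the relation [lin] becomes [2 * d = 0], so both [d] and [K] vanish. *)
have dK0 : K + d != 0.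
  apply/eqP => dK0.
  have Kd : K = - d by lra.
  move: lin dK; rewrite Kd => lin.
  have -> : d = 0 by lra.
  by rewrite oppr0 eqxx => -[].
have <- : expR t = (K - d) / (K + d).
  by apply: (canRL (mulfK dK0)); lra.
by rewrite expRK.
Qed.

Theorem lemma3p5 (R : realType) (v0 : R -> R) (v : R -> R -> R)
    (hv0 : C10 v0) (hv : is_solution v0 v) :
  [/\ forall t : R, 0 <= t -> mean (v t) = mean v0,
      forall t : R, 0 <= t ->
        derive1 (v t) x @[x --> 0^'+] -->
          expR t * deriv_right0 v0
          + (M_cst * v0 0 - pi * m_cst ^+ 2 * mean v0) * (expR t - 1),
      forall t : R, 0 <= t ->
        derive1 (v t) x @[x --> 0^'-] -->
          expR (- t) * deriv_left0 v0
          + (M_cst * v0 0 - pi * m_cst ^+ 2 * mean v0) * (1 - expR (- t)) &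
      C1per v0 ->
      v0 0 <> pi * m_cst ^+ 2 / M_cst * mean v0 \/ derive1 v0 0 <> 0 ->
      {ae @lebesgue_measure R, forall t : R, 0 <= t -> ~ C1per (v t)}].
Proof.
set K := M_cst * v0 0 - pi * m_cst ^+ 2 * mean v0.
have right_lim (t : R) : 0 <= t -> derive1 (v t) x @[x --> 0^'+] -->
    expR t * deriv_right0 v0 + K * (expR t - 1).
  move=> t0; have := solution_deriv_side v0 v deriv_right0 1 (mulr1 1) hv.
  rewrite side1 => /(_ _ t t0); rewrite !mul1r; apply.
  (* The [cvg] clause of [C10] is by definition convergence to the [lim] named [deriv_right0]. *)
  by move=> u [_ _ _].
have left_lim (t : R) : 0 <= t -> derive1 (v t) x @[x --> 0^'-] -->
    expR (- t) * deriv_left0 v0 + K * (1 - expR (- t)).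
  move=> t0; have := solution_deriv_side v0 v deriv_left0 (- 1)
    (etrans (mulrNN 1 1) (mulr1 1)) hv.
  rewrite sideN1 => /(_ _ t t0); rewrite !mulN1r mulNr -mulrN opprB; apply.
  by move=> u [_ _ _].
split => //; first exact: solution_mean.
move=> C1v0 nz.
have [_ _ _ cvr cvl] := hv0.
have [dr dl] : deriv_right0 v0 = derive1 v0 0 /\ deriv_left0 v0 = derive1 v0 0.
  exact: (C1per_one_sided v0).
have nz' : derive1 v0 0 != 0 \/ K != 0.
  case: nz => [nz|/eqP]; [right|by left].
  (* Dividing [K = 0] by [M_cst > 0] gives exactly the excluded value of [v0 0]. *)
  apply/eqP => K0; apply: nz; have M0 := @M_cst_gt0 R.
  have : M_cst * v0 0 = pi * m_cst ^+ 2 * mean v0 by move: K0; rewrite /K; lra.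
  move=> /(canRL (mulKf (lt0r_neq0 M0))) ->; ring.
(* If the quotient is not the exponential of a real, [tc] is a default value, which only adds a
   point to the negligible set. *)
pose tc := ln ((K - derive1 v0 0) / (K + derive1 v0 0)).
have : (@lebesgue_measure R).-negligible ([set 0] `|` [set tc]).
  have neg1 (x : R) : (@lebesgue_measure R).-negligible [set x].
    by exists [set x]; split=> //; exact: lebesgue_measure_set1.
  exact: negligibleU.
apply: negligibleS => t /= /not_implyP[t0 /contrapT C1vt].
have [a b] := C1per_one_sided (v t) _ _ C1vt (right_lim t t0) (left_lim t t0).
apply: (one_sided_values_eq (derive1 v0 0) K) => //.
by move: a b; rewrite dr dl => -> ->.
Qed.
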